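(* Let $\ell>0$ and $d\ge 0$ be integers. Then $$\sum_{\lambda\in\mathcal{P}_d,\ \mu\in\mathcal{P}_{d-\ell}}\big\langle\mu\,\big|\,\alpha_\ell^{\mathbf{q}}\,\big|\,\lambda\big\rangle=\sum_{\lambda\in\mathcal{P}_d,\ \mu\in\mathcal{P}_{d-\ell}}\big\langle\lambda\,\big|\,\alpha_{-\ell}^{\mathbf{q}}\,\big|\,\mu\big\rangle.$$
   Context: $\mathcal{P}_d$ is the set of partitions of $d$ (empty if $d<0$). Let $V$ be the complex vector space with basis $\{\underline{s}\mid s\in\mathbb{Z}+\tfrac12\}$. The semi-infinite wedge space $\mathcal{V}=\Lambda^{\frac\infty2}V$ has basis the vectors $v_S=\underline{s_1}\wedge\underline{s_2}\wedge\cdots$, where $S=\{s_1>s_2>\cdots\}\subset\mathbb{Z}+\tfrac12$ is such that $S_+=S\setminus(\mathbb{Z}_{\leq0}-\tfrac12)$ and $S_-=(\mathbb{Z}_{\leq0}-\tfrac12)\setminus S$ are finite. The inner product $(\cdot,\cdot)$ on $\mathcal{V}$ makes the $v_S$ orthonormal. For a partition $\lambda$, set $|\lambda\rangle=v_\lambda=\underline{\lambda_1-\tfrac12}\wedge\underline{\lambda_2-\tfrac32}\wedge\underline{\lambda_3-\tfrac52}\wedge\cdots$, and for an operator $\mathcal{O}$ set $\langle\mu|\mathcal{O}|\lambda\rangle=(v_\mu,\mathcal{O}v_\lambda)$, where operators and the inner product are extended linearly in the formal commuting variables $(q_j)_{j\in\mathbb{Z}}$. For $k\in\mathbb{Z}+\tfrac12$,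 $\psi_kv_S=\underline{k}\wedge v_S$, and $\psi_k^*$ is the adjoint of $\psi_k$. Normal ordering: $:\psi_i\psi_j^*:\,=\psi_i\psi_j^*$ if $j>0$ and $-\psi_j^*\psi_i$ if $j<0$. The symbol $\vdots\psi_i\psi_j^*\vdots$ denotes the operator obtained from $:\psi_i\psi_j^*:$ by replacing, for each basis vector $v_S$, the coefficient in $:\psi_i\psi_j^*:v_S$ by its absolute value; thus for $i\neq j$, $\vdots\psi_i\psi_j^*\vdots v_S=v_{(S\setminus\{j\})\cup\{i\}}$ if $j\in S$ and $i\notin S$, and $0$ otherwise. For a nonzero integer $E$, the $\mathbf{q}$-twisted free boson operator is $$\alpha_E^{\mathbf{q}}=\sum_{k\in\mathbb{Z}+\frac12}\Big(\prod_{j}q_j\Big)\vdots\psi_{k-E}\psi_k^*\vdots,$$ where the product is over all integers $j$ lying strictly between $k-E$ and $k$, i.e. $k+\tfrac12\leq j\leq k-E-\tfrac12$ if $E<0$ and $k-E+\tfrac12\leq j\leq k-\tfrac12$ if $E>0$. *)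

(* Defs.v *)
From HB Require Import structures.
From mathcomp Require Import all_boot all_order all_algebra finmap.
From mathcomp Require Import boolp classical_sets functions cardinality fsbigop.
From mathcomp Require Import reals.
From mathcomp Require Import complex.
From mathcomp Require Import monalg.

Set Implicit Arguments.
Unset Strict Implicit.
Unset Printing Implicit Defensive.

Import Order.TTheory GRing.Theory Num.Theory.

Local Open Scope classical_set_scope.
Local Open Scope ring_scope.

(* [HalfInt n] is the half-integer n + 1/2. *)
Record half_int := HalfInt { hfloor : int }.

Lemma hfloorK : cancel hfloor HalfInt. Proof. by case. Qed.

HB.instance Definition _ := Choice.copy half_int (can_type hfloorK).

Definition hval (k : half_int) : rat := (hfloor k)%:~R + 2^-1.

Definition hsub (k : half_int) (E : int) : half_int := HalfInt (hfloor k - E).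

Definition neg_half : set half_int := [set s | hval s < 0].

Definition is_maya (S : set half_int) : Prop :=
  finite_set (S `\` neg_half) /\ finite_set (neg_half `\` S).

Record maya := Maya { beads : set half_int; beadsP : `[< is_maya beads >] }.

HB.instance Definition _ := [isSub for beads].
HB.instance Definition _ := [Choice of maya by <:].

Lemma is_maya_add (S : maya) (k : half_int) : `[< is_maya (k |` beads S) >].
Proof.
have /asboolP[fp fm] := beadsP S; apply/asboolP; split.
  apply: (@sub_finite_set _ _ (k |` (beads S `\` neg_half))).
    by move=> x /= [[->|Sx] nx]; [left|right].
  by rewrite finite_setU.
by apply: sub_finite_set fm => x /= [nx nS]; split=> // Sx; apply: nS; right.
Qed.

Definition maya_add (S : maya) (k : half_int) : maya := Maya (is_maya_add S k).

Lemma is_maya_del (S : maya) (k : half_int) : `[< is_maya (beads S `\ k) >].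
Proof.
have /asboolP[fp fm] := beadsP S; apply/asboolP; split.
  by apply: sub_finite_set fp => x /= [[Sx _] nx].
apply: (@sub_finite_set _ _ (k |` (neg_half `\` beads S))).
  move=> x /= [nx nS]; case: (pselect (x = k)) => [->|xk]; [by left|right].
  by split=> // Sx; apply: nS.
by rewrite finite_setU.
Qed.

Definition maya_del (S : maya) (k : half_int) : maya := Maya (is_maya_del S k).

(* {malg A[K]} is the free A-module on K; << S >> is the basis vector v_S. *)
Notation fock R := {malg R[i][maya]}.

(* The polynomial ring C[q_j | j in Z], and the scalar extension of the Fock
   space to it. *)
Notation qpoly R := {malg R[i][{cmonom int}]}.
Notation fockq R := {malg {malg R[i][{cmonom int}]}[maya]}.

Definition qvar (R : realType) (j : int) : qpoly R := << ucm j >>.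

Definition lin_ext (A : comNzRingType) (f : maya -> {malg A[maya]})
    (u : {malg A[maya]}) : {malg A[maya]} :=
  \sum_(S <- msupp u) u@_S *: f S.

Definition inner (R : realType) (u w : fock R) : R[i] :=
  \sum_(S <- msupp u) (u@_S)^* * w@_S.

(* Moving k to its place in k /\ s_1 /\ s_2 /\ ... costs one sign for each
   element of S larger than k; the wedge vanishes if k is already in S. *)
Definition psi (R : realType) (k : half_int) : fock R -> fock R :=
  lin_ext (fun S : maya =>
    if k \in beads S then 0
    else (-1) ^+ #|` fset_set (beads S `&` [set s | hval k < hval s]) | *:
         << maya_add S k >>).

(* The zero map if O has no adjoint; see [psi_starP]. *)
Definition adjoint (R : realType) (O : fock R -> fock R) : fock R -> fock R :=
  xget (fun=> 0)
    [set P : fock R -> fock R | forall u w, inner (O u) w = inner u (P w)].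

Definition psi_star (R : realType) (k : half_int) : fock R -> fock R :=
  adjoint (@psi R k).

Lemma psi_starP (R : realType) (k : half_int) (u w : fock R) :
  inner (psi k u) w = inner u (psi_star k w).
Proof.
pose e (S : maya) := #|` fset_set (beads S `&` [set s | hval k < hval s]) |.
pose f (T : maya) : fock R :=
  if k \in beads T then (-1) ^+ e T *: << maya_del T k >> else 0.
apply: (@xgetPex _ (fun=> 0) [set P : fock R -> fock R |
   forall u w, inner (psi k u) w = inner u (P w)]).
exists (lin_ext f) => {}u {}w /=.
have innerE (v : fock R) (X : {fset maya}) : (msupp v `<=` X)%fset ->
    inner v w = \sum_(S <- X) (v@_S)^* * w@_S.
  move=> vX; rewrite /inner (big_fset_incl _ vX)// => S _ /mcoeff_outdom ->.
  by rewrite conjC0 mul0r.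
have innerE' (v : fock R) : inner v w = \sum_(S <- msupp w) (v@_S)^* * w@_S.
  rewrite (innerE v (msupp v `|` msupp w)%fset) ?fsubsetUl//.
  rewrite [RHS](big_fset_incl _ (fsubsetUr (msupp v) (msupp w)))//.
  by move=> S _ /mcoeff_outdom ->; rewrite mulr0.
rewrite innerE' {1}/psi /lin_ext /inner.
under eq_bigr do rewrite raddf_sum rmorph_sum mulr_suml.
rewrite exchange_big /=; apply: eq_bigr => S _.
under eq_bigr do rewrite mcoeffZ rmorphM -mulrA.
rewrite -mulr_sumr; congr (_ * _); rewrite raddf_sum /=.
apply: eq_bigr => T _; rewrite mcoeffZ mulrC; congr (_ * _).
rewrite /f; case: ifPn => kS; case: ifPn => kT; rewrite ?mcoeff0 ?conjC0//.
- rewrite mcoeffZ mcoeffU; case: eqP => [E|]; last by rewrite mulr0.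
  by move: kS; rewrite in_setE -E => -[_ /(_ erefl)].
- rewrite !mcoeffZ !mcoeffU.
  have -> : (maya_add S k == T) = (maya_del T k == S).
    move: kS kT; rewrite notin_setE inE => kS kT.
    apply/eqP/eqP => [<-|<-]; apply/val_inj => /=.
      rewrite setDUl setDv set0U; apply/seteqP; split=> x /=; first by case.
      by move=> Sx; split=> // xk; apply: kS; rewrite -xk.
    by rewrite setD1K.
  case: eqP => [E|]; rewrite ?mulr0 ?conjC0// !mulr1 rmorphXn rmorphN1.
  congr (_ ^+ #|` fset_set _ |); rewrite -E /=; apply/seteqP.
  split=> x /= [H xk]; first by case: H.
  by split=> //; split=> // xE; rewrite xE ltxx in xk.
- rewrite mcoeffZ mcoeffU; case: eqP => [E|]; last by rewrite mulr0 conjC0.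
  by case/negP: kT; apply/mem_set; rewrite -E; left.
Qed.

Definition normal_ord (R : realType) (i j : half_int) (u : fock R) : fock R :=
  if 0 < hval j then psi i (psi_star j u) else - psi_star j (psi i u).

Definition abs_op (R : realType) (O : fock R -> fock R) : fock R -> fock R :=
  lin_ext (fun S : maya =>
    \sum_(T <- msupp (O << S >>)) << `|(O << S >>)@_T| *g T >>).

Definition dots (R : realType) (i j : half_int) : fock R -> fock R :=
  abs_op (@normal_ord R i j).

Definition to_fockq (R : realType) (u : fock R) : fockq R :=
  \sum_(S <- msupp u) << (u@_S)%:MP *g S >>.

Definition q_ext (R : realType) (O : fock R -> fock R) : fockq R -> fockq R :=
  lin_ext (fun S : maya => to_fockq (O << S >>)).

Definition strictly_between (a b : half_int) : set int :=
  [set j : int | hval a < j%:~R < hval b \/ hval b < j%:~R < hval a].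

(* For E != 0 only finitely many k contribute on a given vector: k must be in
   and k - E not in one of the finitely many S involved, so this finitely
   supported sum is the intended one. *)
Definition alpha (R : realType) (E : int) (u : fockq R) : fockq R :=
  \sum_(k \in [set: half_int])
    (\big[*%R/1]_(j \in strictly_between (hsub k E) k) qvar R j) *:
      q_ext (@dots R (hsub k E) k) u.

Record partition := Partition {
  parts : seq nat;
  partsP : sorted geq parts && (0%N \notin parts)
}.

HB.instance Definition _ := [isSub for parts].
HB.instance Definition _ := [Choice of partition by <:].

Definition partitions_of (d : int) : set partition :=
  [set la : partition | (sumn (parts la))%:Z = d].

Lemma finite_partitions_of (d : int) : finite_set (partitions_of d).
Proof.
case: d => n; last by apply: (@sub_finite_set _ _ set0).
have p0P : sorted geq [::] && (0%N \notin [::]) by [].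
pose g (t : {ffun 'I_n -> 'I_n.+1}) := insubd (Partition p0P)
  [seq m <- [seq nat_of_ord (t i) | i <- enum 'I_n] | m != 0]%N.
apply: (@sub_finite_set _ _ (g @` setT)); last exact/finite_image/finite_finset.
move=> la /= [lan]; have /andP[_ la0] := partsP la.
exists [ffun i : 'I_n => inord (nth 0%N (parts la) i)] => //.
apply: val_inj; rewrite val_insubd; set s := [seq m <- _ | _].
suff -> : s = parts la by rewrite partsP.
have size_le (r : seq nat) : 0%N \notin r -> (size r <= sumn r)%N.
  elim: r => //= -[|m] r IH; rewrite inE ?eqxx//= => /IH H.
  by rewrite addSn ltnS (leq_trans H)// leq_addl.
have nth_le (r : seq nat) i : (nth 0 r i <= sumn r)%N.
  elim: r i => [|m r IH] [|i] //=; first exact: leq_addr.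
  by rewrite (leq_trans (IH i))// leq_addl.
have -> : s = [seq m <- mkseq (nth 0 (parts la)) n | m != 0]%N.
  rewrite /s /mkseq -val_enum_ord -map_comp; congr filter; apply: eq_map => i /=.
  by rewrite ffunE inordK// ltnS (leq_trans (nth_le _ _))// lan.
have szn : (size (parts la) <= n)%N by rewrite -lan size_le.
rewrite -(subnKC szn) /mkseq iotaD map_cat filter_cat add0n.
rewrite -/(mkseq _ _) mkseq_nth [X in X ++ _](all_filterP _); last first.
  by apply/allP => m; apply: contraTneq => ->.
rewrite [X in _ ++ X](_ : _ = [::]) ?cats0//; apply/eqP.
rewrite -[_ == _]negbK -has_filter -all_predC; apply/allP => _ /mapP[i + ->].
by rewrite mem_iota => /andP[si _]; rewrite /= nth_default.
Qed.

Definition part_beads (la : partition) : set half_int :=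
  [set s | exists i : nat,
     hval s = (nth 0%N (parts la) i)%:R - i.+1%:R + 2^-1].

Lemma hval_lt0 (s : half_int) : (hval s < 0) = (hfloor s < 0).
Proof.
have h2 : 0 < (2%:R)^-1 :> rat by [].
have h1 : (2%:R)^-1 < 1 :> rat by [].
apply/idP/idP => H; rewrite /hval in H *.
  by rewrite -(ltrz0 rat); apply: lt_trans H; rewrite ltrDl.
have : (hfloor s)%:~R <= (-1)%:~R :> rat by rewrite ler_int -ltzD1 addNr.
move=> Hle; apply: (le_lt_trans (lerD Hle (lexx _))).
by [].
Qed.

Lemma hval_part (s : half_int) (m n : nat) :
  hval s = m%:R - n%:R + 2^-1 <-> hfloor s = m%:Z - n%:Z.
Proof.
rewrite /hval; split => [/addIr H|->]; last by rewrite rmorphB.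
by apply: (@intr_inj rat); rewrite H rmorphB.
Qed.

Lemma is_maya_part (la : partition) : `[< is_maya (part_beads la) >].
Proof.
apply/asboolP; set n := size (parts la); split.
  apply: (@sub_finite_set _ _
    ((fun i => HalfInt ((nth 0%N (parts la) i)%:Z - i.+1%:Z)) @` `I_n)).
    move=> s /= [[i /hval_part si] /negP]; rewrite /neg_half /= hval_lt0 => s0.
    exists i; last by rewrite -si hfloorK.
    apply: contraT; rewrite -leqNgt => ni; case/negP: s0.
    by rewrite si nth_default// sub0r.
  exact/finite_image/finite_II.
apply: (@sub_finite_set _ _ ((fun i : nat => HalfInt (Negz i)) @` `I_n)).
  move=> s /= []; rewrite /neg_half /= hval_lt0; case: s => -[//|i] _ /= nS.
  exists i => //; apply: contraT; rewrite -leqNgt => ni; case: nS.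
  by exists i; apply/hval_part; rewrite nth_default// sub0r NegzE.
exact/finite_image/finite_II.
Qed.

Definition part_maya (la : partition) : maya := Maya (is_maya_part la).

(* [inner], extended linearly in the q_j in its second argument. *)
Definition innerq (R : realType) (u : fock R) (w : fockq R) : qpoly R :=
  \sum_(S <- msupp u) (u@_S)^* *: w@_S.

Definition bracket (R : realType) (mu : partition) (O : fockq R -> fockq R)
    (la : partition) : qpoly R :=
  innerq << part_maya mu >> (O (to_fockq << part_maya la >>)).

(* Main.v *)
Require Import Defs.
From mathcomp Require Import all_boot all_order all_algebra finmap.
From mathcomp Require Import boolp classical_sets functions cardinality fsbigop.
From mathcomp Require Import reals.
From mathcomp Require Import complex.
From mathcomp Require Import monalg.
From mathcomp Require Import zify.

Set Implicit Arguments.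
Unset Strict Implicit.
Unset Printing Implicit Defensive.

Import Order.TTheory GRing.Theory Num.Theory.

Local Open Scope classical_set_scope.
Local Open Scope ring_scope.

(** The two sums agree term by term, because the operators alpha_E and alpha_(-E)
    are transposes of each other over the polynomials in the q_j ([mcoeff_alphaN]).

    The reason is combinatorial.  Normal ordering affects psi_i psi_j^* only by
    a sign when i != j, and the dotted operator forgets all signs, so on basis
    vectors it is the partial map that moves one bead from j to i
    ([q_ext_dotsU]).  Moving a bead from j to i in S gives T exactly when moving
    a bead from i to j in T gives S ([maya_moveC]), and the weight, a product
    over the integers between the two positions, does not see the direction of
    the move ([q_weightC]).  Shifting the summation index by E therefore turns
    the matrix element of alpha_E from S to T into that of alpha_(-E) from T
    to S ([move_sumC]).

    Reading off a matrix element of alpha_E requires its sum over k to be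
    finitely supported, since the sum of an infinitely supported family is zero
    by convention.  This holds because a Maya diagram differs from the vacuum
    in finitely many positions ([finite_moves]). *)

(** * Moving beads in Maya diagrams *)

Definition maya_move (S : maya) (i j : half_int) : maya :=
  maya_add (maya_del S j) i.

Definition can_move (S : maya) (i j : half_int) : bool :=
  (j \in beads S) && (i \notin beads S).

Lemma setU1_D1K (T : Type) (A : set T) (a : T) : ~ A a -> (a |` A) `\ a = A.
Proof. by move=> Aa; rewrite setDUl setDv set0U not_setD1. Qed.

(** On basis vectors, this is the adjunction between psi_k and psi_k^*, up to
    signs. *)
Lemma maya_add_delE (S T : maya) (k : half_int) :
  (k \notin beads S) && (maya_add S k == T) =
  (k \in beads T) && (maya_del T k == S).
Proof.
apply/andP/andP => -[kS /eqP <-]; split.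
- by rewrite inE; left.
- move: kS; rewrite notin_setE => kS.
  by apply/eqP/val_inj => /=; rewrite setU1_D1K.
- by rewrite notin_setE => -[_ /(_ erefl)].
- move: kS; rewrite inE => kS.
  by apply/eqP/val_inj => /=; rewrite setD1K.
Qed.

(** A move is undone by the opposite move; [can_move S i j] forces i and j to
    be distinct. *)
Lemma maya_moveC (S T : maya) (i j : half_int) :
  (can_move S i j && (maya_move S i j == T)) =
  (can_move T j i && (maya_move T j i == S)).
Proof.
suff moveP (S' T' : maya) a b : can_move S' a b && (maya_move S' a b == T') ->
    can_move T' b a && (maya_move T' b a == S').
  by apply/idP/idP; apply: moveP.
case/andP=> /andP[/set_mem bS]; rewrite notin_setE => aS /eqP<-.
have ab : a <> b by move=> ab; apply: aS; rewrite ab.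
apply/andP; split.
  rewrite /can_move; apply/andP; split; first by rewrite inE; left.
  by rewrite notin_setE => -[ba|[_ /(_ erefl)//]]; apply: ab.
apply/eqP/val_inj; rewrite /= setU1_D1K; first by rewrite setD1K.
by case.
Qed.

(** Let D be the finite set of positions where S differs from the vacuum.  If k
    is occupied and k - E is not, then k lies in D, or k - E lies in D, or the
    vacuum too has k occupied and k - E empty; the last case confines k to the
    |E| positions just below zero. *)
Lemma finite_moves (S : maya) (E : int) :
  finite_set [set k | can_move S (hsub k E) k].
Proof.
have /asboolP[fp fm] := beadsP S.
pose D := (beads S `\` neg_half) `|` (neg_half `\` beads S).
have fD : finite_set D by rewrite finite_setU.
have hsub_inj : injective (hsub^~ E).
  by move=> [m] [n] [] /addIr ->.
have fDE : finite_set ((hsub^~ E) @^-1` D).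
  by apply: finite_preimage => // x y _ _; apply: hsub_inj.
apply: (@sub_finite_set _ _ (D `|` ((hsub^~ E) @^-1` D) `|`
   ((fun m : nat => HalfInt (Negz m)) @` `I_`|E|%N))); last first.
  rewrite finite_setU; split; last exact/finite_image/finite_II.
  by rewrite finite_setU.
move=> k /= /andP[/set_mem kS]; rewrite notin_setE => kES.
have [k0|k0] := pselect (neg_half k); last by left; left; left.
have [kE0|kE0] := pselect (neg_half (hsub k E)); first by left; right; right.
right; move: k0 kE0; rewrite /neg_half /= !hval_lt0.
case: k {kS kES} => -[//|n] _ /= /negP nE; exists n => //=.
by lia.
Qed.

(** The move indexed by k on the right, from k to k + E, reverses the one indexed
    by k + E on the left. *)
Lemma move_sumC (A : comNzRingType) (W : half_int -> half_int -> A)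
    (WC : forall i j, W i j = W j i) (E : int) (S T : maya) :
  \sum_(k \in [set: half_int]) (W (hsub k E) k *
    (can_move S (hsub k E) k && (maya_move S (hsub k E) k == T))%:R) =
  \sum_(k \in [set: half_int]) (W (hsub k (- E)) k *
    (can_move T (hsub k (- E)) k && (maya_move T (hsub k (- E)) k == S))%:R).
Proof.
have hsubK F : cancel (hsub^~ F) (hsub^~ (- F)).
  by case=> n; congr HalfInt; rewrite /= opprK subrK.
have hsubNK : cancel (hsub^~ (- E)) (hsub^~ E).
  by move=> k; have := hsubK (- E) k; rewrite opprK.
rewrite (reindex_fsbigT (hsub^~ (- E))); last by exists (hsub^~ E).
by apply: eq_fsbigr => k _; rewrite hsubNK WC maya_moveC.
Qed.

(** * The fermion operators on basis vectors *)

Section LinearExtension.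
Variable A : comNzRingType.

Lemma msupp_basis (S : maya) : msupp (<< S >> : {malg A[maya]}) = [fset S]%fset.
Proof. by rewrite msuppU oner_eq0. Qed.

Lemma msuppZU_sub (c : A) (S : maya) :
  (msupp (c *: << S >> : {malg A[maya]}) `<=` [fset S])%fset.
Proof.
by apply: fsubset_trans (msuppZ_le _ _) _; rewrite msupp_basis.
Qed.

Lemma lin_extZU (f : maya -> {malg A[maya]}) (c : A) (S : maya) :
  lin_ext f (c *: << S >>) = c *: f S.
Proof.
rewrite /lin_ext (big_fset_incl _ (msuppZU_sub c S)).
  by rewrite big_seq_fset1 mcoeffZ mcoeffUU mulr1.
by move=> T _ /mcoeff_outdom ->; rewrite scale0r.
Qed.

Lemma lin_extU (f : maya -> {malg A[maya]}) (S : maya) :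
  lin_ext f << S >> = f S.
Proof. by rewrite -[<< S >>]scale1r lin_extZU scale1r. Qed.

End LinearExtension.

Section MatrixElements.
Variable R : realType.
Implicit Types (S T : maya) (i j k : half_int).

Lemma innerU S (w : fock R) : inner << S >> w = w@_S.
Proof. by rewrite /inner msupp_basis big_seq_fset1 mcoeffUU conjC1 mul1r. Qed.

Lemma innerZU (c : R[i]) S (w : fock R) :
  inner (c *: << S >>) w = c^* * w@_S.
Proof.
rewrite /inner (big_fset_incl _ (msuppZU_sub c S)).
  by rewrite big_seq_fset1 mcoeffZ mcoeffUU mulr1.
by move=> T _ /mcoeff_outdom ->; rewrite conjC0 mul0r.
Qed.

Lemma inner0l (w : fock R) : inner 0 w = 0.
Proof. by rewrite /inner msupp0 big_seq_fset0. Qed.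

Definition psi_sign k S : R[i] :=
  (-1) ^+ #|` fset_set (beads S `&` [set s | hval k < hval s]) |.

Lemma norm_psi_sign k S : `|psi_sign k S| = 1.
Proof. by rewrite normrX normrN1 expr1n. Qed.

Lemma conj_psi_sign k S : (psi_sign k S)^* = psi_sign k S.
Proof. by rewrite rmorphXn rmorphN1. Qed.

Lemma psi_ZU k S (c : R[i]) :
  psi k (c *: << S >>) =
    if k \in beads S then 0 else (c * psi_sign k S) *: << maya_add S k >>.
Proof.
rewrite /psi lin_extZU; case: (k \in beads S); first by rewrite scaler0.
by rewrite scalerA.
Qed.

Lemma psi_0 k : psi k 0 = 0 :> fock R.
Proof. by rewrite /psi /lin_ext msupp0 big_seq_fset0. Qed.

Lemma psi_star0 k : psi_star k 0 = 0 :> fock R.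
Proof.
apply/malgP => S; rewrite -innerU -psi_starP -[<< S >>]scale1r psi_ZU.
case: (k \in beads S); first by rewrite inner0l mcoeff0.
by rewrite innerZU !mcoeff0 mulr0.
Qed.

(** The adjoint relation determines psi_k^* coefficient by coefficient.  Its sign
    is the one of psi_k at the diagram where the bead k has been removed. *)
Lemma psi_starZU k T (c : R[i]) :
  psi_star k (c *: << T >>) =
    if k \in beads T then (c * psi_sign k (maya_del T k)) *: << maya_del T k >>
    else 0.
Proof.
apply/malgP => S; rewrite -innerU -psi_starP -[<< S >>]scale1r psi_ZU mul1r.
have := maya_add_delE S T k.
case: (boolP (k \in beads S)) => kS; case: (boolP (k \in beads T)) => kT /= E.
- by rewrite inner0l mcoeffZ mcoeffU -E mulr0.
- by rewrite inner0l mcoeff0.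
- rewrite innerZU !mcoeffZ !mcoeffU (eq_sym T) E.
  case: eqP => [<-|_]; last by rewrite !mulr0.
  by rewrite !mulr1 conj_psi_sign mulrC.
- by rewrite innerZU !mcoeffZ !mcoeffU (eq_sym T) E !mulr0 mcoeff0.
Qed.

(** For i != j the fermions anticommute, so both branches of the normal ordering
    perform the same move, up to a sign that [dots] discards. *)
Lemma normal_ordU i j S : i != j -> exists2 c : R[i], `|c| = 1 &
  normal_ord i j << S >> = if can_move S i j then c *: << maya_move S i j >> else 0.
Proof.
move=> ij; rewrite /normal_ord /can_move -[<< S >>]scale1r.
case: (0 < hval j).
  exists (psi_sign j (maya_del S j) * psi_sign i (maya_del S j)).
    by rewrite normrM !norm_psi_sign mul1r.
  rewrite psi_starZU mul1r; case: (j \in beads S); last exact: psi_0.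
  rewrite psi_ZU.
  have -> : (i \in beads (maya_del S j)) = (i \in beads S).
    apply/idP/idP; rewrite !inE /=; first by case.
    by move=> iS; split=> // /eqP; apply/negP.
  by case: (i \in beads S).
exists (- (psi_sign i S * psi_sign j (maya_del (maya_add S i) j))).
  by rewrite normrN normrM !norm_psi_sign mul1r.
rewrite psi_ZU mul1r; case: (i \in beads S) => /=; rewrite ?andbF ?andbT.
  by rewrite psi_star0 oppr0.
rewrite psi_starZU.
have -> : (j \in beads (maya_add S i)) = (j \in beads S).
  apply/idP/idP; rewrite !inE /=; last by right.
  by case=> // /esym /eqP; rewrite (negPf ij).
case: (j \in beads S); last by rewrite oppr0.
rewrite scaleNr; congr (- (_ *: << _ >>)); apply/val_inj => /=.
apply/seteqP; split=> x /=.
  by case=> -[->|Sx] xj; [left|right].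
case=> [->|[Sx xj]]; last by split=> //; right.
by split; [left|apply/eqP].
Qed.

Lemma dotsU i j S : i != j ->
  dots i j << S >> =
    (if can_move S i j then << maya_move S i j >> else 0) :> fock R.
Proof.
move=> /(normal_ordU S)[c c1 E]; rewrite /dots /abs_op lin_extU E.
case: (can_move S i j); last by rewrite msupp0 big_seq_fset0.
rewrite msuppZ -normr_eq0 c1 oner_eq0 msupp_basis big_seq_fset1.
by rewrite mcoeffZ mcoeffUU mulr1 c1.
Qed.

Lemma to_fockqU S : to_fockq << S >> = << S >> :> fockq R.
Proof. by rewrite /to_fockq msupp_basis big_seq_fset1 mcoeffUU. Qed.

Lemma hsub_neq k (E : int) : E != 0 -> hsub k E != k.
Proof.
by move=> E0; apply/eqP => /(congr1 hfloor) /=; lia.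
Qed.

Lemma q_ext_dotsU i j S : i != j ->
  q_ext (@dots R i j) << S >> =
    (if can_move S i j then << maya_move S i j >> else 0) :> fockq R.
Proof.
move=> ij; rewrite /q_ext lin_extU (dotsU _ ij); case: (can_move S i j).
  by rewrite to_fockqU.
by rewrite /to_fockq msupp0 big_seq_fset0.
Qed.

Lemma mcoeff_q_ext_dots i j S T : i != j ->
  (q_ext (@dots R i j) << S >>)@_T =
    (can_move S i j && (maya_move S i j == T))%:R.
Proof.
move=> ij; rewrite (q_ext_dotsU _ ij); case: (can_move S i j) => /=.
  by rewrite mcoeffU.
by rewrite mcoeff0.
Qed.

(** * Matrix elements of the twisted boson operators *)

Definition q_weight (i j : half_int) :=
  \big[*%R/1]_(x \in strictly_between i j) qvar R x.

Lemma q_weightC i j : q_weight i j = q_weight j i.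
Proof.
rewrite /q_weight; congr (\big[_/_]_(_ \in _) _).
by apply/seteqP; split=> x /= [?|?]; [right|left|right|left].
Qed.

Lemma mcoeff_alpha (E : int) S T : E != 0 ->
  (@alpha R E << S >>)@_T =
  \sum_(k \in [set: half_int]) (q_weight (hsub k E) k *
    (can_move S (hsub k E) k && (maya_move S (hsub k E) k == T))%:R).
Proof.
move=> E0; have fS := finite_moves S E.
have notS k : k \notin fset_set [set k | can_move S (hsub k E) k] ->
    can_move S (hsub k E) k = false.
  by rewrite in_fset_set// notin_setE => /negP/negPf.
rewrite /alpha (fsbigTE (fset_set [set k | can_move S (hsub k E) k])); last first.
  by move=> k /notS kS; rewrite q_ext_dotsU ?hsub_neq// kS scaler0.
rewrite [RHS](fsbigTE (fset_set [set k | can_move S (hsub k E) k])); last first.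
  by move=> k /notS ->; rewrite mulr0.
rewrite raddf_sum; apply: eq_bigr => k _ /=.
rewrite mcoeffZ mcoeff_q_ext_dots; first by [].
exact: hsub_neq.
Qed.

Lemma mcoeff_alphaN (E : int) S T : E != 0 ->
  (@alpha R E << S >>)@_T = (@alpha R (- E) << T >>)@_S.
Proof.
move=> E0; have NE0 : - E != 0 by rewrite oppr_eq0.
rewrite (mcoeff_alpha S T E0) (mcoeff_alpha T S NE0).
exact: move_sumC q_weightC E S T.
Qed.

Lemma bracketE mu la (O : fockq R -> fockq R) :
  bracket mu O la = (O << part_maya la >>)@_(part_maya mu).
Proof.
rewrite /bracket /innerq msupp_basis big_seq_fset1 mcoeffUU conjC1 scale1r.
by rewrite to_fockqU.
Qed.

End MatrixElements.

Theorem proposition5p4 (R : realType) (l d : int) (hl : 0 < l) (hd : 0 <= d) :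
  \sum_(la \in partitions_of d) \sum_(mu \in partitions_of (d - l))
     bracket mu (@alpha R l) la
  = \sum_(la \in partitions_of d) \sum_(mu \in partitions_of (d - l))
     bracket la (@alpha R (- l)) mu.
Proof.
apply: eq_fsbigr => la _; apply: eq_fsbigr => mu _.
rewrite !bracketE; apply: mcoeff_alphaN.
by rewrite gt_eqF.
Qed.
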